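(* Let $k\ge 3$ and let $G$ be a girth-regular graph of order $n$, valency $k$, odd girth $g=2h+1$ and signature $\mathbf{a}=(a_1,a_2,\ldots,a_k)$. Then $$n\ge \frac{k(k-1)^h-2}{k-2}+\left\lceil\frac{k(k-1)^h-\sum_{i=1}^k a_i}{k}\right\rceil.$$
   Context: All graphs are simple, finite and connected, and valency $k>2$ is assumed throughout. For a $k$-regular graph of girth $g$, the signature of a vertex $v$ is the sequence $(a_1,\ldots,a_k)$, listed in non-decreasing order, of the numbers of $g$-cycles containing each of the $k$ edges incident with $v$; the graph is girth-regular if all vertices have the same signature, which is then called the signature of the graph. *)

(* Defs.v *)
From mathcomp Require Import all_boot.

Set Implicit Arguments.
Unset Strict Implicit.
Unset Printing Implicit Defensive.

(* A finite simple graph is a symmetric irreflexive relation e : rel T on a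
   finType T; the vertex set is T and e is adjacency. *)
Section Graph.

Variables (T : finType) (e : rel T).

Definition simple_graph : Prop := symmetric e /\ irreflexive e.

Definition connected_graph : Prop := forall u v : T, connect e u v.

Definition neighbours (v : T) : {set T} := [set w | e v w].

Definition regular_graph (k : nat) : Prop := forall v : T, #|neighbours v| = k.

(* The bound on the size excludes a single edge traversed back and forth. *)
Definition graph_cycle (c : seq T) : bool :=
  [&& 2 < size c, uniq c & cycle e c].

Definition cycle_edges (c : seq T) : {set {set T}} :=
  [set [set x; next c x] | x in c].

Definition is_girth (g : nat) : Prop :=
  (exists2 c : seq T, graph_cycle c & size c = g) /\
  (forall c : seq T, graph_cycle c -> g <= size c).

(* Cycles are counted as subgraphs, hence identified with their edge sets:
   the choice of a starting point and of an orientation is forgotten. *)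
Definition cycles (g : nat) : {set {set {set T}}} :=
  [set cycle_edges c | c : g.-tuple T & graph_cycle c].

Definition cycles_through (g : nat) (u v : T) : nat :=
  #|[set C in cycles g | [set u; v] \in C]|.

Definition signature (g : nat) (v : T) : seq nat :=
  sort leq [seq cycles_through g v w | w in neighbours v].

Definition girth_regular (g : nat) : Prop :=
  forall u v : T, signature g u = signature g v.

End Graph.

(* Main.v *)
(* Fix a vertex v. Because the girth is 2h+1, simple paths from v of length at
   most h are determined by their endpoints, so the ball of radius h around v
   contains at least 1 + k + k(k-1) + ... + k(k-1)^(h-1) vertices. There are at
   least k(k-1)^h simple paths of length h+1 from v. At most k of them end at
   any given vertex outside the ball; one that ends in the ball is closed to a
   girth cycle by the length-h path to its endpoint, and is recovered from that
   cycle together with its first edge, so there are at most a_1 + ... + a_k of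
   these. Hence k(k-1)^h - (a_1 + ... + a_k) is at most k times the number of
   vertices outside the ball. *)
Require Import Defs.
From mathcomp Require Import all_boot all_order all_algebra.
From mathcomp Require Import zify.

Set Implicit Arguments.
Unset Strict Implicit.
Unset Printing Implicit Defensive.

Import Order.TTheory GRing.Theory Num.Theory.

(** * Counting along sequences *)

Lemma size_le_card_inj (A : eqType) (B : finType) (f : A -> B)
    (s : seq A) (D : {set B}) :
  uniq s -> {in s &, injective f} -> {in s, forall x, f x \in D} ->
  size s <= #|D|.
Proof.
move=> s_uniq f_inj fD; rewrite -(size_map f) cardE; apply: uniq_leq_size.
  by rewrite map_inj_in_uniq.
by move=> _ /mapP[x xs ->]; rewrite mem_enum fD.
Qed.

Lemma leq_size_sumn (A : eqType) (f : A -> nat) (m : nat) (s : seq A) :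
  {in s, forall x, m <= f x} -> size s * m <= sumn [seq f x | x <- s].
Proof.
elim: s => //= x s IH fm; rewrite mulSn leq_add ?fm ?mem_head // IH // => y ys.
by rewrite fm // inE ys orbT.
Qed.

(** * Cycles recovered from their edge sets *)

Section Cycles.

Variables (T : finType).
Implicit Types (c : seq T) (x y : T).

Lemma next_next_neq c x : 2 < size c -> uniq c -> x \in c ->
  next c (next c x) != x.
Proof.
move=> c_gt2 c_uniq /rot_to[i c' def_c].
have c'_uniq : uniq (x :: c') by rewrite -def_c rot_uniq.
have c'_gt2 : 2 < size (x :: c') by rewrite -def_c size_rot.
rewrite -!(next_rot i c_uniq) def_c.
case: c' {def_c} c'_uniq c'_gt2 => [|y [|z c']] //=.
rewrite !inE !negb_or -!andbA => /and5P[xy xz _ yz _] _.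
by rewrite !eqxx [y == x]eq_sym (negPf xy) eq_sym.
Qed.

Lemma traject_next x c : uniq (x :: c) ->
  x :: c = traject (next (x :: c)) x (size c).+1.
Proof.
move=> c_uniq; have : fpath (next (x :: c)) x c.
  by have := cycle_next c_uniq; rewrite /= rcons_path => /andP[].
case/fpathP=> n def_c.
have size_c : size c = n by rewrite def_c size_traject.
by rewrite size_c trajectS -def_c.
Qed.

(* On a cycle every vertex lies on two edges, so a traversal can be continued
   in only one way once its first edge is known. *)
Lemma cycle_edges_inj x c c' :
  2 < size (x :: c) -> uniq (x :: c) -> uniq (x :: c') ->
  size c = size c' -> next (x :: c) x = next (x :: c') x ->
  cycle_edges (x :: c) = cycle_edges (x :: c') -> c = c'.
Proof.
set f := next (x :: c); set f' := next (x :: c').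
move=> c_gt2 c_uniq c'_uniq size_c fx edges.
have fc n : iter n f x \in x :: c.
  by elim: n => [|n IH]; rewrite ?mem_head // iterS mem_next.
have fc' n : iter n f' x \in x :: c'.
  by elim: n => [|n IH]; rewrite ?mem_head // iterS mem_next.
(* Two consecutive iterates are carried, since the next edge is forced only once the edge just
   traversed is known. *)
have eq_iter n : iter n f x = iter n f' x /\ iter n.+1 f x = iter n.+1 f' x.
  elim: n => [|n [IH1 IH2]]; first by split.
  split=> //; set z := iter n f x in IH1.
  have : [set iter n.+1 f x; iter n.+2 f x] \in cycle_edges (x :: c').
    by rewrite -edges; apply/imsetP; exists (iter n.+1 f x).
  case/imsetP=> t tc' /setP E.
  have := E (iter n.+2 f x); rewrite !inE eqxx orbT -/f' => /esym.
  have := E (iter n.+1 f x); rewrite !inE eqxx -/f' => /esym.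
  have back : iter n.+2 f x != z := next_next_neq c_gt2 c_uniq (fc n).
  case/orP=> /eqP E1.
    case/orP=> /eqP E2; last by rewrite E2 -E1 IH2.
    move: (E (f' t)); rewrite !inE eqxx orbT E1 E2 orbb => /eqP E3.
    by rewrite [RHS]iterS -IH2 E1 E3.
  case/orP=> /eqP E2; last first.
    move: (E t); rewrite !inE eqxx E1 E2 orbb => /eqP E3.
    by rewrite [RHS]iterS -IH2 E1 -E3.
  (* Here the second cycle runs the edge backwards; injectivity of [f'] gives [t = z], so the first
     cycle would turn straight back, against [back]. *)
  case/eqP: back; rewrite E2.
  have : f' t = f' z by rewrite -E1 IH2 IH1.
  by move/(congr1 (prev (x :: c'))); rewrite !prev_next.
suff [] : x :: c = x :: c' by [].
rewrite (traject_next c_uniq) (traject_next c'_uniq) -size_c.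
rewrite -/f -/f'.
apply: (@eq_from_nth _ x); rewrite !size_traject // => i i_lt.
by rewrite !nth_traject //; case: (eq_iter i).
Qed.

End Cycles.

(** * Simple paths and the cycles they close *)

Section Paths.

Variables (T : finType) (e : rel T).
Hypotheses (e_sym : symmetric e) (e_irr : irreflexive e).

Definition simple_path v p := path e v p && uniq (v :: p).

Lemma simple_path_cat v p q :
  simple_path v (p ++ q) -> simple_path v p /\ simple_path (last v p) q.
Proof.
rewrite /simple_path cat_path => /andP[/andP[-> ->]].
rewrite -cat_cons cat_uniq => /and3P[-> disj q_uniq]; split=> //=.
rewrite q_uniq andbT; apply: contra disj => v_q; apply/hasP.
by exists (last v p) => //; apply: mem_last.
Qed.

Lemma simple_path_neq_gt0 v p q :
  simple_path v p -> last v p = last v q -> p != q -> 0 < size q.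
Proof.
case: q => // pv last_p; case: p pv last_p => // w p /andP[_ /andP[]] /=.
by move=> + _ last_p; rewrite -[X in X \notin _]last_p mem_last.
Qed.

(** The stretch of the path from [y] to [x] is closed by the edge between them; as [y] does not
    immediately precede [x], it has at least three vertices. *)
Lemma chord_cycle v s x y :
  simple_path v (rcons s x) -> e x y -> y \in v :: rcons s x ->
  y != last v s ->
  exists2 c, graph_cycle e c & size c <= (size s).+2.
Proof.
move=> sx exy; rewrite -rcons_cons mem_rcons inE => /orP[/eqP yx|].
  by rewrite yx e_irr in exy.
move=> y_s; case/path.splitPl: y_s sx => p1 p2 y_last; rewrite -{}y_last in exy *.
rewrite rcons_cat => /simple_path_cat[_ /andP[p2x p2u]].
rewrite last_cat => p2_n0; exists (last v p1 :: rcons p2 x); last first.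
  by rewrite /= size_rcons size_cat ltnS ltnS leq_addl.
apply/and3P; split=> //; last by rewrite /= rcons_path p2x last_rcons.
by case: p2 p2_n0 {p2x p2u} => [|z p2]; rewrite ?eqxx //= size_rcons.
Qed.

(** Strong induction on the total length. Paths meeting only at their ends form a cycle: out along
    [p], back along [q], with [behead] dropping the shared endpoint. Otherwise both are cut at a
    common inner vertex, and one of the two shorter pairs still consists of distinct paths. *)
Lemma two_paths_cycle v p q :
  simple_path v p -> simple_path v q -> last v p = last v q -> p != q ->
  graph_cycle e (v :: p ++ behead (rev q))
  \/ exists2 c, graph_cycle e c & size c < size p + size q.
Proof.
have [n] := ubnP (size p + size q); elim: n => // n IH in v p q *.
rewrite ltnS => le_n sp sq last_pq p_neq_q.
case: (boolP (has [pred z | (z \in q) && (z != last v p)] p)) => [|disj].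
  case/hasP=> z zp /andP[zq z_last]; right.
  (* Either alternative for a shorter pair gives a cycle with at most [size p' + size q'] vertices,
     hence a strictly shorter one. *)
  have IHle u p' q' : size p' + size q' < size p + size q ->
      simple_path u p' -> simple_path u q' -> last u p' = last u q' ->
      p' != q' ->
      exists2 c, graph_cycle e c & size c < size p + size q.
    move=> lt_pq sp' sq' last' neq'.
    case: (IH u p' q' (leq_trans lt_pq le_n) sp' sq' last' neq') => [cyc|].
      have q'_n0 := simple_path_neq_gt0 sp' last' neq'.
      exists (u :: p' ++ behead (rev q')) => //.
      by rewrite /= size_cat size_behead size_rev -addnS prednK.
    by case=> c cyc lt_c; exists c => //; apply: ltn_trans lt_pq.
  case/path.splitP: zp z_last sp IHle last_pq p_neq_q {le_n} => p1 p2.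
  case/path.splitP: zq sq => q1 q2.
  rewrite !last_cat !last_rcons => sq z_last sp IHle last_pq.
  have [sp1 sp2] := simple_path_cat sp.
  have [sq1 sq2] := simple_path_cat sq.
  rewrite !last_rcons in sp2 sq2.
  have p2_n0 : 0 < size p2 by case: (p2) z_last => //=; rewrite eqxx.
  have [eq1|neq1] := eqVneq (rcons p1 z) (rcons q1 z) => p_neq_q.
    apply: (IHle z p2 q2) => //; last first.
      by apply: contraNneq p_neq_q => ->; rewrite eq1.
    by rewrite !size_cat addnACA -[X in X < _]add0n ltn_add2r size_rcons.
  apply: (IHle v (rcons p1 z) (rcons q1 z)); rewrite ?last_rcons //.
  by rewrite !size_cat addnACA -[X in X < _]addn0 ltn_add2l addn_gt0 p2_n0.
left; have := simple_path_neq_gt0 sp last_pq p_neq_q.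
case: (lastP q) => // q' y in sq last_pq p_neq_q disj le_n * => _.
rewrite last_rcons in last_pq; rewrite rev_rcons /=.
case/andP: sp => p_path /andP[v_p p_uniq].
case/andP: sq => q_path; rewrite -rcons_cons rcons_uniq inE negb_or.
case/andP=> /andP[y_v y_q'] /= /andP[v_q' q'_uniq].
apply/and3P; split.
(* Fewer than three vertices would force both paths to be the same single edge. *)
- case: p last_pq p_neq_q {p_path v_p p_uniq disj le_n} => [/= vy|w p].
    by rewrite vy eqxx in y_v.
  case: p => [/= ->|] //=; rewrite size_rev.
  by case: q' {q_path y_q' v_q' q'_uniq} => [|? ?]; rewrite ?eqxx //= addn1.
- rewrite cons_uniq mem_cat mem_rev negb_or v_p v_q' cat_uniq [uniq p]p_uniq.
  rewrite rev_uniq [uniq q']q'_uniq /= andbT; apply/hasPn => z; rewrite mem_rev => zq'.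
  apply: contra disj => zp.
  apply/hasP; exists z => //=; rewrite mem_rcons inE zq' orbT /= last_pq.
  by apply: contraNneq y_q' => <-.
- rewrite /= rcons_cat cat_path p_path last_pq -rev_cons.
  have := rev_path e v (rcons q' y); rewrite last_rcons belast_rcons => ->.
  by rewrite (eq_path (e' := e)) // => a b; apply: e_sym.
Qed.

Fixpoint paths_from v n : seq (seq T) :=
  if n is n'.+1 then
    [seq rcons s y | s <- paths_from v n',
                     y <- enum [set y in neighbours e (last v s)
                               | y \notin v :: s]]
  else [:: [::]].

Lemma mem_paths_from v n s :
  (s \in paths_from v n) = (size s == n) && simple_path v s.
Proof.
elim: n s => [|n IH] s /=; first by rewrite inE; case: s.
apply/allpairsPdep/idP => [[s' [y [s's ys' ->]]]|].
  move: s's ys'; rewrite IH mem_enum !inE size_rcons eqSS.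
  case/and3P=> -> s'_path s'_uniq /andP[e_y y_s'].
  rewrite /simple_path rcons_path s'_path e_y -rcons_cons rcons_uniq s'_uniq.
  by rewrite inE y_s'.
case/lastP: s => // s y; rewrite size_rcons eqSS /simple_path rcons_path.
rewrite -rcons_cons rcons_uniq => /and4P[s_n /andP[s_path e_y] y_s s_uniq].
exists s, y; split=> //; first by rewrite IH s_n /simple_path s_path.
by rewrite mem_enum inE inE e_y.
Qed.

Lemma paths_from_uniq v n : uniq (paths_from v n).
Proof.
elim: n => //= n IH; apply: allpairs_uniq_dep => //.
  by move=> s _; apply: enum_uniq.
by move=> [s y] [s' y'] _ _ /= /rcons_inj[-> ->].
Qed.

End Paths.

(** * Counting paths around a vertex *)

Section Girth.

Variables (T : finType) (e : rel T) (k h : nat) (v : T).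
Hypotheses (e_sym : symmetric e) (e_irr : irreflexive e).
Hypotheses (e_reg : regular_graph e k) (h_gt0 : 0 < h).
Hypothesis girth_ge : forall c, graph_cycle e c -> 2 * h + 1 <= size c.

(** A path of length between 1 and [h] has at least [k.-1] extensions: a neighbour of its endpoint
    lying on it, other than the predecessor, would close a cycle with at most [h + 1] vertices. *)
Lemma size_paths_from_ge n : n <= h ->
  k * k.-1 ^ n <= size (paths_from e v n.+1).
Proof.
elim: n => [|n IH] n_h.
  rewrite /= cats0 size_map -cardE muln1 -(e_reg v); apply: subset_leq_card.
  apply/subsetP=> y; rewrite !inE /= => e_y; rewrite e_y.
  by apply: contraTneq e_y => ->; rewrite e_irr.
have {}IH := IH (ltnW n_h).
rewrite [paths_from e v n.+2]/= size_allpairs_dep expnSr mulnA.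
apply: leq_trans (leq_mul IH (leqnn _)) _.
apply: leq_size_sumn => s; rewrite mem_paths_from => /andP[].
case/lastP: s => // s x; rewrite size_rcons eqSS => /eqP s_n sx.
rewrite last_rcons -cardE -(e_reg x) -subn1 leq_subLR.
rewrite (cardsD1 (last v s)) leq_add ?leq_b1 //.
apply: subset_leq_card; apply/subsetP=> y; rewrite !inE => /andP[y_s e_y].
rewrite e_y; apply/negP => y_sx.
have [c /girth_ge c_ge c_le] := chord_cycle e_irr sx e_y y_sx y_s.
have := leq_trans c_ge c_le.
by rewrite s_n; lia.
Qed.

Definition ball_paths :=
  [seq s | n <- iota 0 h.+1, s <- paths_from e v n].

Lemma mem_ball_paths s :
  (s \in ball_paths) = (size s <= h) && simple_path e v s.
Proof.
apply/allpairsPdep/idP => [[n [s' [n_h s's ->]]]|/andP[s_h sv]].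
  move: n_h s's; rewrite mem_iota mem_paths_from /= add0n ltnS.
  by move=> n_h /andP[/eqP-> ->]; rewrite n_h.
exists (size s), s; rewrite mem_iota /= add0n ltnS s_h.
by rewrite mem_paths_from eqxx sv.
Qed.

Lemma ball_paths_uniq : uniq ball_paths.
Proof.
apply: allpairs_uniq_dep => [|n _|]; first exact: iota_uniq.
  exact: paths_from_uniq.
move=> _ _ /allpairsPdep[n [s [_ + ->]]] /allpairsPdep[n' [s' [_ + ->]]] /=.
by rewrite !mem_paths_from => /andP[/eqP<- _] /andP[/eqP<- _] ->.
Qed.

(** The geometric sum over the layers, with the denominator [k - 2] cleared and the 2 moved across
    to avoid truncated subtraction. *)
Lemma size_ball_paths_ge : 1 < k ->
  k * k.-1 ^ h <= (k - 2) * size ball_paths + 2.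
Proof.
move=> k_gt1; rewrite size_allpairs_dep.
(* Only the number of layers is generalised; the radius [h] that bounds it stays fixed. *)
elim: {-2}h (leqnn h) => [|m IH] m_h; first by rewrite /= expn0 !muln1 subnK.
rewrite -(addn1 m.+1) iotaD map_cat sumn_cat.
rewrite [sumn [seq _ | _ <- iota (_ + _) _]]addn0.
rewrite mulnDr addnAC expnS mulnCA {1}(_ : k.-1 = 1 + (k - 2)); last by lia.
by rewrite mulnDl mul1n leq_add ?IH ?leq_mul ?size_paths_from_ge // ltnW.
Qed.

Lemma short_paths_inj p q :
  simple_path e v p -> simple_path e v q -> last v p = last v q ->
  size p + size q < 2 * h + 1 -> p = q.
Proof.
move=> pv qv last_pq lt_pq; apply/eqP/contraT => neq.
have q_n0 := simple_path_neq_gt0 pv last_pq neq.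
case: (two_paths_cycle e_sym pv qv last_pq neq) => [/girth_ge|[c /girth_ge]].
  rewrite /= size_cat size_behead size_rev -addnS prednK //.
  by rewrite leqNgt lt_pq.
by move=> c_ge /(leq_ltn_trans c_ge) /(ltn_trans lt_pq); rewrite ltnn.
Qed.

(** Keeps the order of [ball_paths], so the index of a vertex here retrieves the path leading to
    it. *)
Definition ball := [seq last v s | s <- ball_paths].

Lemma ball_uniq : uniq ball.
Proof.
rewrite map_inj_in_uniq ?ball_paths_uniq // => p q.
rewrite !mem_ball_paths => /andP[p_h pv] /andP[q_h qv] last_pq.
by apply: short_paths_inj => //; rewrite addn1 ltnS mul2n -addnn leq_add.
Qed.

Definition outside : {set T} := [set y | y \notin ball].

Lemma card_outside : size ball_paths + #|outside| = #|T|.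
Proof.
rewrite -(size_map (last v)) -/ball -(card_uniqP ball_uniq) -(cardC (mem ball)).
by congr (_ + _); apply: eq_card => y; rewrite !inE.
Qed.

(** Such a path is determined by its last two vertices, because its first [h] steps are determined
    by where they end; each endpoint has [k] possible predecessors. *)
Lemma leaving_paths_le :
  size [seq s <- paths_from e v h.+1 | last v s \notin ball] <= k * #|outside|.
Proof.
pose f (s : seq T) := (last v s, last v (rev (behead (rev s)))).
have fE s x : f (rcons s x) = (x, last v s).
  by rewrite /f last_rcons rev_rcons /= revK.
apply: leq_trans (@size_le_card_inj _ _ f _
  [set yx : T * T | (yx.1 \in outside) && (yx.2 \in neighbours e yx.1)] _ _ _) _.
- exact/filter_uniq/paths_from_uniq.
- move=> p q; rewrite !mem_filter !mem_paths_from.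
  case/lastP: p => [|p x]; first by rewrite andbF.
  case/lastP: q => [|q y]; first by rewrite andbF.
  rewrite !size_rcons !eqSS -!cats1.
  case/and3P=> _ /eqP p_h /simple_path_cat[pv _].
  case/and3P=> _ /eqP q_h /simple_path_cat[qv _].
  rewrite !cats1 !fE => -[-> last_pq].
  by rewrite (short_paths_inj pv qv last_pq) // p_h q_h addnn mul2n addn1.
- move=> s; rewrite mem_filter mem_paths_from.
  case/lastP: s => [|s x]; first by rewrite andbF.
  rewrite fE last_rcons !inE /= /simple_path rcons_path.
  by case/and4P=> -> _ /andP[_ e_x] _; rewrite e_sym.
rewrite -sum1_card (eq_bigl (fun yx : T * T =>
  (yx.1 \in outside) && (yx.2 \in neighbours e yx.1))); last first.
  by move=> yx; rewrite [LHS]inE.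
rewrite -(pair_big_dep (fun y => y \in outside)
  (fun y x => x \in neighbours e y) (fun _ _ => 1)) /=.
rewrite (eq_bigr (fun=> k)) ?sum_nat_const 1?mulnC // => y _.
by rewrite sum1_card e_reg.
Qed.

(* A path of length [h.+1] from [v] back to the ball is closed up by the path of
   length [h] to its endpoint, and can be read off the resulting girth cycle
   given its first edge. *)
Lemma returning_paths_le :
  size [seq s <- paths_from e v h.+1 | last v s \in ball]
  <= \sum_(w in neighbours e v) cycles_through e (2 * h + 1) v w.
Proof.
(* The short path to the endpoint of [s]; the default [[::]] is never reached when that endpoint
   lies in [ball]. *)
pose q (s : seq T) := nth [::] ball_paths (index (last v s) ball).
pose t s := behead (rev (q s)).
have cyc s : s \in [seq s <- paths_from e v h.+1 | last v s \in ball] ->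
    [/\ size s = h.+1, size (v :: s ++ t s) = 2 * h + 1
      & graph_cycle e (v :: s ++ t s)].
  rewrite mem_filter mem_paths_from => /and3P[s_ball /eqP s_h sv].
  have i_lt : index (last v s) ball < size ball_paths.
    by rewrite -(size_map (last v)) index_mem.
  have qs : q s \in ball_paths by apply: mem_nth.
  have last_q : last v s = last v (q s).
    by rewrite -[LHS](nth_index v s_ball) (nth_map [::]).
  move: qs; rewrite mem_ball_paths => /andP[q_h qv].
  have neq : s != q s by apply: contraTneq q_h => <-; rewrite s_h ltnn.
  (* This upper bound meets the girth bound, so the closed walk is a cycle of length exactly
     [2 * h + 1]. *)
  have size_sq : size s + size (q s) <= 2 * h + 1.
    by rewrite s_h addSn addn1 ltnS mul2n -addnn leq_add2l.
  case: (two_paths_cycle e_sym sv qv last_q neq) => [c_cyc|[c]].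
    split=> //; apply/eqP; rewrite eqn_leq girth_ge // andbT.
    apply: leq_trans size_sq; rewrite /= size_cat /t size_behead size_rev.
    by rewrite -addnS prednK // (simple_path_neq_gt0 sv).
  move=> /girth_ge c_ge c_lt; have := leq_trans c_lt size_sq.
  by rewrite ltnNge c_ge.
(* The first vertex fixes starting edge and orientation, so the edge set yields [s ++ t s], whose
   first [h.+1] entries are [s]. *)
pose f (s : seq T) := (head v s, cycle_edges (v :: s ++ t s)).
have next_v s : s \in [seq s <- paths_from e v h.+1 | last v s \in ball] ->
    next (v :: s ++ t s) v = head v s.
  by case/cyc; case: s => //= w s _ _ _; rewrite eqxx.
apply: leq_trans (@size_le_card_inj _ _ f _ [set wC : T * {set {set T}} |
  (wC.1 \in neighbours e v) &&
  (wC.2 \in [set C in cycles e (2 * h + 1) | [set v; wC.1] \in C])] _ _ _) _.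
- exact/filter_uniq/paths_from_uniq.
- move=> s s' ss ss' [head_s edges_s].
  have [s_h size_s /and3P[c_gt2 c_uniq _]] := cyc s ss.
  have [s'_h size_s' /and3P[_ c'_uniq _]] := cyc s' ss'.
  have : s ++ t s = s' ++ t s'.
    apply: cycle_edges_inj c_gt2 c_uniq c'_uniq _ _ edges_s.
      by apply: succn_inj; move: size_s size_s' => /= -> ->.
    by rewrite !next_v.
  by move/eqP; rewrite eqseq_cat ?s_h ?s'_h // => /andP[/eqP].
- move=> s ss; have [s_h size_s c_cyc] := cyc s ss.
  have edge_v : [set v; head v s] \in cycle_edges (v :: s ++ t s).
    by apply/imsetP; exists v; rewrite ?mem_head // next_v.
  rewrite [f s \in _]inE /= !inE edge_v andbT; apply/andP; split.
    case: s c_cyc s_h {ss size_s edge_v} => // w s /and3P[_ _ /=].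
    by case/andP.
  by apply/imsetP; exists (Tuple (introT eqP size_s)); rewrite ?inE.
rewrite -sum1_card (eq_bigl (fun wC : T * {set {set T}} =>
  (wC.1 \in neighbours e v) &&
  (wC.2 \in [set C in cycles e (2 * h + 1) | [set v; wC.1] \in C]))); last first.
  by move=> wC; rewrite [LHS]inE.
rewrite -(pair_big_dep (fun w => w \in neighbours e v)
  (fun w C => C \in [set C in cycles e (2 * h + 1) | [set v; w] \in C])
  (fun _ _ => 1)) /=.
by apply: leq_sum => w _; rewrite sum1_card.
Qed.

Lemma boundary_le : k * k.-1 ^ h <=
  k * #|outside| + \sum_(w in neighbours e v) cycles_through e (2 * h + 1) v w.
Proof.
apply: leq_trans (size_paths_from_ge (leqnn h)) _.
rewrite -(count_predC (fun s => last v s \in ball)) addnC -!size_filter.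
by rewrite leq_add ?leaving_paths_le ?returning_paths_le.
Qed.

End Girth.

(** * The bound over the rationals *)

Local Open Scope ring_scope.

Theorem theorem4p2 (T : finType) (e : rel T) (k h : nat) (a : k.-tuple nat)
  (k_ge3 : (3 <= k)%N)
  (e_simple : simple_graph e)
  (e_connected : connected_graph e)
  (e_regular : regular_graph e k)
  (e_girth : is_girth e (2 * h + 1)%N)
  (e_girth_regular : girth_regular e (2 * h + 1)%N)
  (e_signature : forall v : T, signature e (2 * h + 1)%N v = a) :
  (k%:R * (k%:R - 1) ^+ h - 2) / (k%:R - 2)
  + (Num.ceil ((k%:R * (k%:R - 1) ^+ h - \sum_(i < k) (tnth a i)%:R) / k%:R
               : rat))%:~R
  <= #|T|%:R :> rat.
Proof.
have [e_sym e_irr] := e_simple; have [[c c_cyc c_g] girth_ge] := e_girth.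
have c_gt2 : (2 < size c)%N by case/and3P: c_cyc.
(* For [h = 0] the girth would be 1, but cycles have at least three vertices. *)
have h_gt0 : (0 < h)%N by move: c_gt2; rewrite c_g; case: (h).
have [v _] : exists v, v \in c.
  by case: c c_gt2 {c_cyc c_g} => // v c; exists v; apply: mem_head.
have sum_a : (\sum_(w in neighbours e v) cycles_through e (2 * h + 1) v w
    = \sum_(i < k) tnth a i)%N.
  rewrite -(big_tuple _ _ a xpredT id) -(e_signature v) /signature.
  by rewrite (perm_big _ (permEl (perm_sort _ _))) big_map -big_enum.
have ball_ge :=
  size_ball_paths_ge v e_irr e_regular h_gt0 girth_ge (ltnW k_ge3).
have := boundary_le v e_sym e_irr e_regular h_gt0 girth_ge; rewrite sum_a.
rewrite -(card_outside v e_sym girth_ge).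
set b := size _ in ball_ge *; set o := #|_| => bound.
have k1 : (k.-1%:R = k%:R - 1 :> rat) by rewrite -subn1 natrB // ltnW // ltnW.
have k2 : ((k - 2)%:R = k%:R - 2 :> rat) by rewrite natrB // ltnW.
have powE : k%:R * (k%:R - 1) ^+ h = (k * k.-1 ^ h)%N%:R :> rat.
  by rewrite natrM natrX k1.
rewrite powE -natr_sum natrD lerD //.
  rewrite -k2 ler_pdivrMr ?ltr0n ?subn_gt0 // lerBlDr mulrC.
  by rewrite -natrM -[2]/(2%:R) -natrD ler_nat.
(* The number of outside vertices is an integer, so bounding the ceiling amounts to bounding the
   quotient itself. *)
rewrite -[o%:R]/((o%:Z)%:~R) ler_int ceil_le_int.
rewrite ler_pdivrMr ?ltr0n ?(ltn_trans _ k_ge3) // lerBlDr.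
by rewrite mulrC -[o%:~R]/(o%:R) -natrM -natrD ler_nat.
Qed.
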